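(* Let $X$ be a metric space and let $E$ be a subset of $X$ which is locally compact and has countably many connected components. Then, for every $\delta\in(0,+\infty]$, $$\mathscr{H}^1(E)=L_\delta(E).$$
   Context: $X$ is a metric space with distance $d$; $\operatorname{diam}(E)=\sup\{d(x,x'):x,x'\in E\}$. The one-dimensional Hausdorff measure of $E\subset X$ is $\mathscr{H}^1(E):=\sup_{\delta>0}\mathscr{H}^1_\delta(E)$, where $\mathscr{H}^1_\delta(E):=\inf\sum_i\operatorname{diam}(E_i)$, the infimum being over all countable families $\{E_i\}$ of subsets of $X$ which cover $E$ and satisfy $\operatorname{diam}(E_i)\le\delta$. A continuum is a connected compact metric space (or subset of a metric space). For $\delta\in(0,+\infty]$ and $E\subset X$, $L_\delta(E):=\sup\sum_i\operatorname{diam}(E_i)$, where the supremum is taken over all finite families $\{E_i\}$ of pairwise disjoint continua contained in $E$ with $\operatorname{diam}(E_i)\le\delta$ for every $i$. A connected component of $E$ is a nonempty connected subset of $E$ which is maximal with respect to inclusion. *)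

(* Defs.v *)
From HB Require Import structures.
From mathcomp Require Import all_boot all_order all_algebra.
From mathcomp Require Import all_classical all_reals all_analysis.

Set Implicit Arguments.
Unset Strict Implicit.
Unset Printing Implicit Defensive.

Import Order.TTheory GRing.Theory Num.Theory.

Local Open Scope classical_set_scope.
Local Open Scope ring_scope.
Local Open Scope ereal_scope.

Section definitions.
Context {R : realType} {X : metricType R}.
Implicit Types (A E : set X) (delta : \bar R).

(* The supremum is taken in [0, +oo]: [ereal_sup set0 = -oo], so the maximum
   with 0 makes the diameter of the empty set equal to 0. *)
Definition diam A : \bar R :=
  maxe 0 (ereal_sup [set z | exists x y, [/\ A x, A y & z = (mdist x y)%:E]]).

(* A sequence may contain empty sets, which have diameter 0, so sequences
   also account for the finite covers. *)
Definition hausdorff1_delta delta E : \bar R :=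
  ereal_inf [set z | exists F : nat -> set X,
    [/\ E `<=` \bigcup_i F i,
        forall i, diam (F i) <= delta &
        z = \sum_(0 <= i <oo) diam (F i)]].

Definition hausdorff1 E : \bar R :=
  ereal_sup [set hausdorff1_delta delta E | delta in [set delta | 0 < delta]].

Definition continuum A : Prop := connected A /\ compact A.

Definition L_delta delta E : \bar R :=
  ereal_sup [set z | exists (n : nat) (F : 'I_n -> set X),
    [/\ forall i, continuum (F i),
        forall i, F i `<=` E,
        trivIset [set: 'I_n] F,
        forall i, diam (F i) <= delta &
        z = \sum_(i < n) diam (F i)]].

(* [locally_compact E] would only ask for compact neighbourhoods in [X], which
   need not be contained in [E] (it holds for the rationals in the reals).
   The subspace topology makes the points outside [E] isolated, hence
   irrelevant; see [locally_compact_inP]. *)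
Definition locally_compact_in E : Prop := locally_compact [set: subspace E].

Definition components E : set (set X) := connected_component E @` E.

Lemma locally_compact_inP E : locally_compact_in E <->
  forall x, E x -> exists K : set X,
    [/\ K `<=` E, compact K & within E (nbhs x) K].
Proof.
have nbhsE (x : subspace E) : E x -> nbhs x = within E (nbhs (x : X)).
  by move=> Ex; rewrite nbhs_subspace_in.
have hE : hausdorff_space (subspace E).
  exact/subspace_hausdorff/metric_hausdorff.
split=> [lcE x Ex|lcE x _].
  have [U] := lcE x I; rewrite withinET nbhsE// => xU [cU _].
  exists (U `&` E); split; first by move=> y [].
    apply/(@compact_subspaceIP _ E U); apply: compact_closedI => //.
    exact: closed_subspaceT.
  by apply: (@filterS _ (nbhs x) _ _ _ _ xU) => y yU Ey; split=> //; exact: yU.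
have [Ex|nEx] := pselect (E x).
  have [K [KE cK xK]] := lcE x Ex.
  have cK' : compact (K : set (subspace E)).
    by rewrite -(setIidl KE); apply/(@compact_subspaceIP _ E K); rewrite setIidl.
  exists K; first by rewrite withinET nbhsE.
  by split=> //; exact: compact_closed.
exists ([set x] : set (subspace E)).
  by rewrite withinET /nbhs/= -nbhs_subspace_out.
split; first exact: compact_set1.
by apply: compact_closed => //; exact: compact_set1.
Qed.

Lemma componentsP E A : components E A <->
  [/\ A !=set0, A `<=` E, connected A &
      forall B, A `<=` B -> B `<=` E -> connected B -> B = A].
Proof.
split=> [[x Ex <-]|[[x Ax] AE cA Amax]].
  split; first by exists x; exact: connected_component_refl.
  - exact: connected_component_sub.
  - exact: component_connected.
  move=> B AB BE cB; apply/seteqP; split=> //; apply: connected_component_max => //.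
  by apply: AB; exact: connected_component_refl.
exists x; first exact: AE.
apply: Amax; last exact: component_connected.
  exact: connected_component_max.
exact: connected_component_sub.
Qed.

End definitions.

(* Main.v *)
(** [L_delta <= H^1]: finitely many disjoint compact sets lie at positive mutual
distance, so the pieces of a fine cover split among them, and each continuum
has [H^1_delta] at least its diameter by projection to the line.

[H^1 <= L_delta]: it is enough to show [H^1_{5 e} E <= L_e E] when the right
side is finite. Choose greedily disjoint continua [C_n] in [E] of diameter at
most [e], each with at least half the largest diameter still available. Their
diameters have sum at most [L_e E]. A point [x] of [E] outside
[C_0, .., C_(N-1)] whose component is not [{x}] lies in a nondegenerate
continuum in [E] missing them; by greediness it meets some later [C_n] whose
diameter is at least half of its own, as in Vitali's covering lemma, so [x]
lies in a neighbourhood of [C_n] of diameter at most [5 diam C_n]. Hence [E] is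
covered by [C_0, .., C_(N-1)], these neighbourhoods for [n >= N], and countably
many points; let [N] go to infinity. *)
Require Import Defs.
From mathcomp Require Import all_boot all_order all_algebra.
From mathcomp Require Import all_classical all_reals all_analysis.
From mathcomp Require Import lra.

Import Order.TTheory GRing.Theory Num.Theory.
Import numFieldNormedType.Exports.

Local Open Scope classical_set_scope.
Local Open Scope ring_scope.
Local Open Scope ereal_scope.

(** * Quasicomponents of a compact set are connected *)

Section quasicomponent.
Context {T : topologicalType} (hT : hausdorff_space T).
Implicit Types (K D W : set T) (x : T).

(* For compact [K], being clopen in [K] amounts to being compact with compact
   complement; this avoids the subspace topology. *)
Definition clopen_in K x D :=
  [/\ D x, D `<=` K, compact D & compact (K `\` D)].

Definition quasicomponent K x : set T := \bigcap_(D in clopen_in K x) D.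

Lemma clopen_inT K x : compact K -> K x -> clopen_in K x K.
Proof. by move=> cK Kx; split=> //; rewrite setDv; exact: compact0. Qed.

Lemma clopen_inI K x D D' :
  clopen_in K x D -> clopen_in K x D' -> clopen_in K x (D `&` D').
Proof.
move=> [Dx DK cD cKD] [D'x _ cD' cKD']; split=> //.
- by move=> y [/DK].
- by apply: compact_closedI => //; exact: compact_closed.
- by rewrite setDIr; exact: compactU.
Qed.

Lemma quasicomponent_sub K x : compact K -> K x -> quasicomponent K x `<=` K.
Proof. by move=> cK Kx y; apply; exact: clopen_inT. Qed.

Lemma quasicomponent_refl K x : quasicomponent K x x.
Proof. by move=> D []. Qed.

Lemma quasicomponent_compact K x :
  compact K -> K x -> compact (quasicomponent K x).
Proof.
move=> cK Kx; apply: subclosed_compact cK (quasicomponent_sub _ _ cK Kx).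
by apply: closed_bigI => D [_ _ cD _]; exact: compact_closed.
Qed.

(** If no clopen piece [D] fits in [W], the sets [D \ W] generate a proper filter on [K]; a cluster
    point of it lies in every [D], hence in the quasicomponent, but not in [W]. *)
Lemma quasicomponent_nbhs K x W : compact K -> K x -> open W ->
  quasicomponent K x `<=` W -> exists2 D, clopen_in K x D & D `<=` W.
Proof.
move=> cK Kx oW QW; apply: contrapT => noD.
have FF : ProperFilter (filter_from (clopen_in K x) (fun D => D `\` W)).
  apply: filter_from_proper.
    apply: filter_from_filter; first by exists K; exact: clopen_inT.
    move=> D D' cD cD'; exists (D `&` D'); first exact: clopen_inI.
    by move=> y [[]].
  move=> D cD; apply/set0P/eqP; rewrite setD_eq0 => DW.
  by apply: noD; exists D.
have [|p [Kp clp]] := cK _ FF.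
  by exists K; [exact: clopen_inT|move=> y []].
have inDW D : clopen_in K x D -> (D `\` W) p.
  move=> cD; have /closure_id -> : closed (D `\` W).
    apply: closedI; last exact: open_closedC.
    by case: cD => _ _ + _; exact: compact_closed.
  by move=> U pU; apply: clp => //; exists D.
have [_ []] := inDW _ (clopen_inT _ _ cK Kx).
by apply: QW => D /inDW[].
Qed.

Context (nT : forall A B : set T, closed A -> closed B -> A `&` B = set0 ->
  exists U V, [/\ open U, open V, A `<=` U, B `<=` V & U `&` V = set0]).

(** If disjoint open [U] and [V] separate two closed halves, with [x] in [U], some clopen [D] lies
    in their union; [D] minus [V] is again clopen, so the quasicomponent misses the half inside
    [V]. *)
Lemma quasicomponent_connected K x :
  compact K -> K x -> connected (quasicomponent K x).
Proof.
move=> cK Kx.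
set Q := quasicomponent K x.
have clQ : closed Q.
  by apply: compact_closed => //; exact: quasicomponent_compact.
suff split_side P S : closed P -> closed S -> P `&` S = set0 -> Q = P `|` S ->
    P x -> S = set0.
  move=> B [b Bb] [W oW BW] [F cF BF].
  have cB : closed B by rewrite BF; exact: closedI.
  have cB' : closed (Q `\` B).
    by rewrite BW setDIr setDv set0U; apply: closedI => //; exact: open_closedC.
  have BQ : B `<=` Q by rewrite BW => y [].
  have QE : Q = B `|` Q `\` B by rewrite setDUK.
  have BB' : B `&` (Q `\` B) = set0 by rewrite setDE setICA setICr setI0.
  have [Bx|nBx] := pselect (B x).
    have := split_side _ _ cB cB' BB' QE Bx.
    by rewrite setD_eq0 => ?; apply/seteqP; split.
  have B0 : B = set0.
    apply: split_side cB' cB _ _ _; first by rewrite setIC.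
      by rewrite setUC.
    by split=> //; exact: quasicomponent_refl.
  by rewrite B0 in Bb.
move=> cP cS PS0 QE Px.
have [U [V [oU oV PU SV UV0]]] := nT _ _ cP cS PS0.
have [|D Dcl DUV] := quasicomponent_nbhs _ _ (U `|` V) cK Kx (openU oU oV).
  by rewrite -/Q QE; exact: setUSS.
have [Dx DK cD cKD] := Dcl.
have nUV y : U y -> V y -> False.
  by move=> Uy Vy; have : (U `&` V) y by []; rewrite UV0.
have DclU : clopen_in K x (D `&` ~` V).
  split.
  - by split=> // Vx; apply: nUV Vx; exact: PU.
  - by move=> y [/DK].
  - by apply: compact_closedI => //; exact: open_closedC.
  - rewrite (_ : _ `\` _ = (K `\` D) `|` (D `&` ~` U)).
      apply: compactU => //.
      by apply: compact_closedI => //; exact: open_closedC.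
    rewrite setDIr !setDE setCK; apply/seteqP; split=> y.
      case=> [|[Ky Vy]]; first by left.
      have [Dy|nDy] := pselect (D y); last by left.
      by right; split=> // Uy; exact: nUV Uy Vy.
    case=> [|[Dy nUy]]; first by left.
    by right; split; [exact: DK|case: (DUV _ Dy)].
rewrite -subset0 => y Sy.
have : Q y by rewrite QE; right.
by move=> /(_ _ DclU)[_]; apply; exact: SV.
Qed.

End quasicomponent.

(** * Small nondegenerate continua avoiding a closed set *)

Section bump.
Context {R : realType} {X : metricType R}.
Implicit Types (E G K : set X) (x y : X).

Lemma metric_separation (A B : set X) :
  closed A -> closed B -> A `&` B = set0 ->
  exists U V, [/\ open U, open V, A `<=` U, B `<=` V & U `&` V = set0].
Proof. by move: A B; apply/(@normal_openP R); exact: pseudometric_normal. Qed.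

Lemma open_mball x (r : R) : open [set y | (mdist x y < r)%R].
Proof.
rewrite openE => y /= xyr; apply/nbhs_ballP.
exists (r - mdist x y)%R; first by rewrite /= subr_gt0.
rewrite ballEmdist => z /= yz; have := metric_triangle x y z; lra.
Qed.

Lemma closed_mball x (r : R) : closed [set y | (mdist x y <= r)%R].
Proof.
rewrite -openC openE => y /= /negP; rewrite -ltNge => xyr; apply/nbhs_ballP.
exists (mdist x y - r)%R; first by rewrite /= subr_gt0.
rewrite ballEmdist => z /= yz; apply/negP; rewrite -ltNge.
have := metric_triangle x z y; rewrite (metric_sym z y); lra.
Qed.

(* Boundary bumping: take the quasicomponent [Q] of [x] in a small compact ball.
   If [Q = {x}], some clopen piece of that ball avoids its boundary, hence is
   clopen in the component of [x] in [E], a contradiction. *)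
Lemma nondegenerate_subcontinuum E G x (e : R) : locally_compact_in E ->
  closed G -> ~ G x -> E x -> connected_component E x <> [set x] ->
  (0 < e)%R ->
  exists C, [/\ C x, C `<=` E `\` G, continuum C,
    (forall y z, C y -> C z -> (mdist y z <= e)%R) &
    (exists2 y, C y & y <> x)].
Proof.
move=> /locally_compact_inP lcE cG nGx Ex nd e0.
have [K [KE cK /nbhs_ballP[r1 /= r10 r1K]]] := lcE _ Ex.
rewrite ballEmdist in r1K.
have /nbhs_ballP[r2 /= r20 r2G] : nbhs x (~` G).
  by apply: open_nbhs_nbhs; split=> //; exact: closed_openC.
rewrite ballEmdist in r2G.
have [y Ay yx] : exists2 y, connected_component E x y & y <> x.
  apply: contrapT => noy; apply: nd; apply/seteqP; split=> y /=.
    by move=> Ay; apply: contrapT => yx; apply: noy; exists y.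
  by move=> ->; exact: connected_component_refl.
have dxy : (0 < mdist x y)%R by rewrite mdist_gt0; apply/eqP => /esym.
(* Within [E], the closed [r]-ball lies in [K] ([r < r1]) and misses [G] ([r < r2]); [r <= e / 2]
   bounds its diameter by [e], and [r < mdist x y] excludes [y]. *)
pose r := Num.min (Num.min (r1 / 2)%R (r2 / 2)%R)
  (Num.min (e / 2)%R (mdist x y / 2)%R).
have r0 : (0 < r)%R by rewrite !lt_min !divr_gt0.
have [rr1 rr2 re rxy] :
    [/\ (r < r1)%R, (r < r2)%R, (r <= e / 2)%R & (r < mdist x y)%R].
  rewrite !gt_min !ge_min lexx /= orbT.
  by split=> //; apply/orP; [left|left|right]; apply/orP;
    [left|right|right]; lra.
pose K' := K `&` [set z | (mdist x z <= r)%R].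
have cK' : compact K' by apply: compact_closedI => //; exact: closed_mball.
have K'x : K' x.
  split; last by rewrite /= mdistxx ltW.
  by apply: r1K => //=; rewrite mdistxx.
have hX : hausdorff_space X by exact: metric_hausdorff.
set Q := quasicomponent K' x.
have QK' : Q `<=` K' by exact: quasicomponent_sub.
exists Q; split.
- exact: quasicomponent_refl.
- move=> z /QK'[/KE Ez /= xz]; split=> //; apply: r2G => /=.
  exact: le_lt_trans rr2.
- split; last exact: quasicomponent_compact.
  by apply: quasicomponent_connected => //; exact: metric_separation.
- move=> z t /QK'[_ /= xz] /QK'[_ /= xt].
  by have := metric_triangle z x t; rewrite (metric_sym z x); lra.
- apply: contrapT => noz.
  have [|D [Dx DK' cD cKD] Dr] :=
      quasicomponent_nbhs hX _ _ _ cK' K'x (open_mball x r).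
    move=> z Qz /=; have [->|zx] := pselect (z = x); first by rewrite mdistxx.
    by exfalso; apply: noz; exists z.
  (* [D] stays in the open ball, so removing the compact [K' \ D] from that ball shows that [D] is
     relatively open in the component; connectedness then forces [D] to contain [y]. *)
  have AE : connected_component E x `&` D = connected_component E x.
    apply: (@component_connected _ E x).
    + by exists x; split=> //; exact: connected_component_refl.
    + exists ([set z | (mdist x z < r)%R] `&` ~` (K' `\` D)).
        apply: openI; first exact: open_mball.
        by apply: closed_openC; exact: compact_closed.
      apply/seteqP; split=> z [Az].
        by move=> Dz; split=> //; split; [exact: Dr|case].
      move=> [/= xz nKD]; split=> //; apply: contrapT => nDz; apply: nKD.
      split=> //; split; last exact: ltW.
      apply: r1K; first by rewrite /= (lt_trans xz).
      exact: connected_component_sub Az.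
    + by exists D => //; exact: compact_closed.
  have : (connected_component E x `&` D) y by rewrite AE.
  by move=> [_ /Dr /=]; lra.
Qed.

End bump.

(** * Diameters, and the bound of [L_delta] by [hausdorff1] *)

Section diam.
Context {R : realType} {X : metricType R}.
Implicit Types (A B E : set X) (x y : X) (delta : \bar R).

Lemma diam_ge0 A : 0 <= diam A.
Proof. by rewrite /diam le_max lexx. Qed.

Lemma mdist_le_diam A x y : A x -> A y -> (mdist x y)%:E <= diam A.
Proof.
move=> Ax Ay; rewrite /diam le_max; apply/orP; right.
by apply: ereal_sup_ubound; exists x, y.
Qed.

Lemma diam_le A (r : \bar R) : 0 <= r ->
  (forall x y, A x -> A y -> (mdist x y)%:E <= r) -> diam A <= r.
Proof.
move=> r0 Ar; rewrite /diam ge_max r0/=.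
by apply: ge_ereal_sup => _ [x [y [Ax Ay ->]]]; exact: Ar.
Qed.

Lemma le_diam A B : A `<=` B -> diam A <= diam B.
Proof.
move=> AB; apply: diam_le; first exact: diam_ge0.
by move=> x y /AB Bx /AB By; exact: mdist_le_diam.
Qed.

Lemma diam_subsingleton A : (forall x y, A x -> A y -> x = y) -> diam A = 0.
Proof.
move=> A1; apply/eqP; rewrite eq_le diam_ge0 andbT.
apply: diam_le => // x y Ax Ay.
by rewrite (A1 _ _ Ax Ay) mdistxx.
Qed.

Lemma diam0 : diam (@set0 X) = 0.
Proof. exact: diam_subsingleton. Qed.

Lemma hausdorff1_delta_le delta delta' E : delta <= delta' ->
  hausdorff1_delta delta' E <= hausdorff1_delta delta E.
Proof.
move=> dd'; apply: ereal_inf_le_tmp => _ [F [EF Fd ->]]; exists F; split=> // i.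
exact: le_trans (Fd i) dd'.
Qed.

Lemma L_delta_le delta delta' E : delta <= delta' ->
  L_delta delta E <= L_delta delta' E.
Proof.
move=> dd'; apply: ereal_sup_le => _ [n [F [cF FE tF Fd ->]]].
exists n, F; split=> // i; exact: le_trans (Fd i) dd'.
Qed.

Lemma continuous_mdist x : continuous (mdist x : X -> R).
Proof.
move=> y; apply/cvgrPdist_lt => e e0; apply/nbhs_ballP.
exists e => //; rewrite ballEmdist => z /= yz.
have := metric_triangle x y z; have := metric_triangle x z y.
rewrite (metric_sym z y) ltr_norml => h1 h2.
by apply/andP; split; lra.
Qed.

(* Project to the real line by the distance to a point and compare with the
   Lebesgue measure of the image. *)
Lemma connected_diam_le_cover A (F : nat -> set X) : connected A ->
  A `<=` \bigcup_i F i -> diam A <= \sum_(0 <= i <oo) diam (F i).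
Proof.
move=> cA AF; apply: diam_le.
  by apply: nneseries_ge0 => i _ _; exact: diam_ge0.
move=> x y Ax Ay.
have [finF|/existsNP[k nfin]] := pselect (forall i, diam (F i) \is a fin_num);
  last first.
  rewrite (@nneseries_pinfty _ _ _ k) ?leey// => [i _|].
    exact: diam_ge0.
  by have := diam_ge0 (F k); move: nfin; case: (diam (F k)).
pose f := mdist x : X -> R.
(* [mdist x] is 1-Lipschitz, so the interval of length [diam (F i)] starting at the infimum contains
   the image of [F i]; for empty [F i] it is a single point. *)
pose I i : interval R :=
  `[inf (f @` F i), (inf (f @` F i) + fine (diam (F i)))%R].
have IE i : lebesgue_measure [set` I i] = diam (F i).
  rewrite lebesgue_measure_itv /= lte_fin ltrDl.
  have [d0|] := ltP 0%R (fine (diam (F i))).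
    by rewrite -EFinB addrAC subrr add0r fineK.
  move=> d0; rewrite -[RHS]fineK//; congr EFin; apply/eqP.
  by rewrite eq_le d0 fine_ge0// diam_ge0.
have FI i z : F i z -> [set` I i] (f z).
  move=> Fz; rewrite /= in_itv /=; apply/andP; split.
    apply: ge_inf; last by exists z.
    by exists 0%R => _ [t _ <-]; exact: mdist_ge0.
  rewrite -lerBlDr; apply: lb_le_inf; first by exists (f z), z.
  move=> _ [t Ft <-]; rewrite lerBlDr.
  have := mdist_le_diam _ _ _ Ft Fz; rewrite -[diam _]fineK// lee_fin.
  by have := metric_triangle x t z; rewrite /f; lra.
have sub : [set` `[0%R, f y]] `<=` \bigcup_i [set` I i].
  have : connected (f @` A).
    apply: connected_continuous_connected => //.
    exact/continuous_subspaceT/continuous_mdist.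
  move=> /connected_intervalP /(_ 0%R (f y)) itv z /=.
  rewrite in_itv /= => z0y; have [||t At <-] := itv _ _ z z0y.
  - by exists x => //; exact: mdistxx.
  - by exists y.
  have [i _ Fit] := AF _ At; exists i => //; exact: FI.
have : lebesgue_measure [set` `[0%R, f y]] <=
    \sum_(0 <= i <oo) lebesgue_measure [set` I i].
  by apply: measure_sigma_subadditive => // i; exact: measurable_itv.
rewrite lebesgue_measure_itv /= lte_fin oppr0 adde0 => h.
rewrite -/(f y); apply: (@le_trans _ _ (if (0 < f y)%R then (f y)%:E else 0)).
  by case: ltP; rewrite ?lee_fin.
apply: le_trans h _.
by apply: lee_nneseries => [i _ _|i _]; rewrite IE// diam_ge0.
Qed.

(** Each point of [A] has a ball with a uniform gap to [B], and the near-covering form of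
    compactness makes the gap uniform on [A]. Stated near [0^'+], the gaps of finitely many pairs
    can be intersected. *)
Lemma compact_disjoint_gap A B : compact A -> closed B -> A `&` B = set0 ->
  \forall e \near 0^'+, forall y z, A y -> B z -> (e < mdist y z)%R.
Proof.
move=> /compact_near_coveringP cA cB AB0.
suff : \forall e \near 0^'+,
    A `<=` [set y | forall z, B z -> (e < mdist y z)%R].
  by apply: filterS => e Ae y z Ay; exact: Ae.
apply: cA => y Ay.
have /nbhs_ballP[r /= r0 rB] : nbhs y (~` B).
  apply: open_nbhs_nbhs; split; first exact: closed_openC.
  by move=> By; have : (A `&` B) y by []; rewrite AB0.
rewrite ballEmdist in rB.
exists ([set y' | (mdist y y' < r / 2)%R], [set e | (e < r / 2)%R]) => /=.
  split; last by apply: nbhs_right_lt; rewrite divr_gt0.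
  apply/nbhs_ballP; exists (r / 2)%R => /=; first by rewrite divr_gt0.
  by rewrite ballEmdist.
move=> [y' e] /= [yy' er] z Bz.
have : ~ (mdist y z < r)%R by move=> /rB.
move/negP; rewrite -leNgt => ryz.
by have := metric_triangle y y' z; lra.
Qed.

Lemma L_delta_le_hausdorff1 delta E : L_delta delta E <= hausdorff1 E.
Proof.
apply: ge_ereal_sup => _ [n [F [cF FE tF _ ->]]].
have gap : \forall e \near 0^'+, forall i j : 'I_n, i != j ->
    forall y z, F i y -> F j z -> (e < mdist y z)%R.
  apply: filter_forall => i; apply: filter_forall => j.
  have [->|ij] := eqVneq i j; first exact: nearW.
  near=> e => _; near: e; apply: compact_disjoint_gap.
  - by case: (cF i).
  - by apply: compact_closed; [exact: metric_hausdorff|case: (cF j)].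
  - rewrite -subset0 => x Fx; move/eqP: ij; apply; apply: tF => //; by exists x.
have [e /= [e0 eF]] : exists e : R, (0 < e)%R /\ forall i j : 'I_n, i != j ->
    forall y z, F i y -> F j z -> (e < mdist y z)%R.
  near (0%R : R)^'+ => e; exists e; split; near: e; last exact: gap.
  exact: nbhs_right_gt.
apply: (@le_trans _ _ (hausdorff1_delta e%:E E)); last first.
  by apply: ereal_sup_ubound; exists e%:E => //=; rewrite lte_fin.
apply: le_ereal_inf_tmp => _ [G [EG Ge ->]].
(* The traces of the [G k] cover each [F i]. After exchanging the sums, each [G k] meets at most one
   [F i], because its diameter is at most [e], below every gap. *)
apply: (@le_trans _ _ (\sum_(i < n) \sum_(0 <= k <oo) diam (G k `&` F i))).
  apply: lee_sum => i _; apply: connected_diam_le_cover; first by case: (cF i).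
  by move=> x Fx; have [k _ Gx] := EG _ (FE _ _ Fx); exists k.
rewrite -nneseries_sum => [|i j _]; last exact: diam_ge0.
apply: lee_nneseries => [k _ _|k _].
  by apply: sume_ge0 => i _; exact: diam_ge0.
have [[i [x [Gx Fx]]]|noi] := pselect (exists i, G k `&` F i !=set0).
  rewrite (bigD1 i)//= big1 => [|j ji].
    by rewrite adde0; apply: le_diam => y [].
  rewrite (_ : _ `&` _ = set0) ?diam0// -subset0 => y [Gy Fy].
  have /le_trans/(_ (Ge k)) := mdist_le_diam _ _ _ Gy Gx; rewrite lee_fin.
  by apply/negP; rewrite -ltNge; exact: eF Fy Fx.
rewrite big1 ?diam_ge0// => i _.
rewrite (_ : _ `&` _ = set0) ?diam0// -subset0 => y GFy.
by apply: noi; exists i, y.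
Unshelve. all: by end_near. Qed.

End diam.

(** * Null covers, one greedy choice, and the enlargement of a continuum *)

Section greedy.
Context {R : realType} {X : metricType R}.
Implicit Types (A B E G : set X) (x y : X) (delta : \bar R).

(** Interleaving [A] at even and [B] at odd indices gives one cover whose even-length partial sums
    are those of [A]. *)
Lemma hausdorff1_deltaU_null delta E (A B : nat -> set X) : 0 <= delta ->
  E `<=` (\bigcup_i A i) `|` (\bigcup_i B i) ->
  (forall i, diam (A i) <= delta) -> (forall i, diam (B i) = 0) ->
  hausdorff1_delta delta E <= \sum_(0 <= i <oo) diam (A i).
Proof.
move=> d0 EAB Ad B0; apply: ge_ereal_inf.
pose F i := if odd i then B i./2 else A i./2.
exists (\sum_(0 <= i <oo) diam (F i)).
  exists F; split=> // [x /EAB[[i _ Ax]|[i _ Bx]]|i].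
  - by exists i.*2 => //; rewrite /F odd_double doubleK.
  - by exists i.*2.+1 => //; rewrite /F /= odd_double /= uphalf_double.
  - by rewrite /F; case: ifP => _; rewrite ?B0.
have partial n : \sum_(0 <= i < n.*2) diam (F i) = \sum_(0 <= i < n) diam (A i).
  elim: n => [|n IHn]; first by rewrite !big_nil.
  rewrite doubleS !big_nat_recr//= IHn /F /= odd_double /= uphalf_double.
  by rewrite doubleK B0 adde0.
apply: lime_le; first by apply: is_cvg_nneseries => i _ _; exact: diam_ge0.
apply: nearW => n; apply: (@le_trans _ _ (\sum_(0 <= i < n.*2) diam (F i))).
  apply: lee_sum_nneg_natr => [i _ _|]; first exact: diam_ge0.
  by rewrite -addnn leq_addr.
by rewrite partial; apply: nneseries_lim_ge => i _ _; exact: diam_ge0.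
Qed.

(* The process never stops: the empty continuum is admissible. *)
Lemma greedy_continuum E G (e : R) : (0 <= e)%R -> exists C,
  [/\ continuum C, C `<=` E `\` G, diam C <= e%:E &
    forall C', continuum C' -> C' `<=` E `\` G -> diam C' <= e%:E ->
      diam C' <= 2%:E * diam C].
Proof.
move=> e0.
pose adm C := [/\ continuum C, C `<=` E `\` G & diam C <= e%:E].
pose s := ereal_sup [set diam C | C in adm].
have se : s <= e%:E by apply: ge_ereal_sup => _ [C [_ _ Ce] <-].
have adm0 : adm set0.
  by split=> //; [split; [exact: connected0|exact: compact0]|rewrite diam0].
have s0 : 0 <= s by apply: ereal_sup_ubound; exists set0; rewrite ?diam0.
have sfin : s \is a fin_num by rewrite ge0_fin_numE// (le_lt_trans se) ?ltry.
have ubs C : adm C -> diam C <= s.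
  by move=> aC; apply: ereal_sup_ubound; exists C.
(* If [s] vanishes, all admissible continua have diameter 0 and the empty one will do; otherwise the
   diameter of some admissible [C] exceeds half of the finite [s]. *)
have [s_gt0|s_le0] := ltP 0 s; last first.
  exists set0; case: adm0 => c0 s0' d0; split=> // C' cC' C'E C'e.
  by rewrite diam0 mule0 (le_trans _ s_le0)// ubs.
have : (fine s / 2)%:E < s.
  by move: s_gt0; rewrite -(fineK sfin) !lte_fin; lra.
move=> /ereal_sup_gt[_ [C [cC CE Ce] <-] sC].
exists C; split=> // C' cC' C'E C'e; apply: (le_trans (ubs _ _)) => //.
have Cfin : diam C \is a fin_num.
  by rewrite ge0_fin_numE ?diam_ge0// (le_lt_trans Ce) ?ltry.
move: sC; rewrite -(fineK Cfin) -(fineK sfin) -EFinM lte_fin lee_fin fineK//.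
by lra.
Qed.

(** The radius suits Vitali's argument: every set that meets [C] and has diameter at most
    [2 * diam C] is swallowed. *)
Definition inflate C : set X :=
  [set y | exists2 c, C c & (mdist y c)%:E <= 2%:E * diam C].

Lemma inflate_sub C : C `<=` inflate C.
Proof.
by move=> c Cc; exists c => //; rewrite mdistxx mule_ge0// diam_ge0.
Qed.

(** The constant is 2 + 1 + 2: from one point into [C], across [C], and out to the other point. *)
Lemma diam_inflate C : diam (inflate C) <= 5%:E * diam C.
Proof.
have [Cfin|] := boolP (diam C \is a fin_num); last first.
  rewrite ge0_fin_numE ?diam_ge0// -leNgt leye_eq => /eqP ->.
  by rewrite gt0_muley ?leey.
apply: diam_le; first by rewrite mule_ge0// diam_ge0.
move=> x y [c Cc xc] [c' Cc' yc'].
have := mdist_le_diam _ _ _ Cc Cc'; move: xc yc'.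
rewrite -(fineK Cfin) -!EFinM !lee_fin.
have := metric_triangle x c y; have := metric_triangle c c' y.
rewrite (metric_sym c' y); lra.
Qed.

End greedy.

(** * Vitali covering by a greedy sequence *)

Section greedy_sequence.
Context {R : realType} {X : metricType R}.
Implicit Types (A B E G : set X) (x y : X) (delta : \bar R).

Lemma greedy_sequence E (e : R) : (0 <= e)%R -> exists C : nat -> set X,
  [/\ forall n, continuum (C n),
    forall n, C n `<=` E `\` \big[setU/set0]_(i < n) C i,
    forall n, diam (C n) <= e%:E &
    forall n C', continuum C' -> C' `<=` E `\` \big[setU/set0]_(i < n) C i ->
      diam C' <= e%:E -> diam C' <= 2%:E * diam (C n)].
Proof.
move=> e0.
have [c cP] := choice (fun G => greedy_continuum E G e e0).
(* The iteration carries the union of the continua already chosen, which is all that the next choice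
   depends on. *)
pose U n := iter n (fun G => G `|` c G) set0.
have UE n : U n = \big[setU/set0]_(i < n) c (U i).
  by elim: n => [|n IHn]; rewrite ?big_ord0// big_ord_recr /= -IHn.
by exists (c \o U); split=> n /=; rewrite -?UE; case: (cP (U n)).
Qed.

Definition degenerate E : set X := [set x | connected_component E x = [set x]].

(** An injective coding of the components indexes the cover; each index receives at most one point,
    since equal codes mean equal singleton components. *)
Lemma degenerate_null_cover E : countable (components E) ->
  exists B : nat -> set X, E `&` degenerate E `<=` \bigcup_i B i /\
    forall i, diam (B i) = 0.
Proof.
move=> /countable_injP[f finj].
exists (fun i => [set x | [/\ E x, degenerate E x &
  f (connected_component E x) = i]]); split=> [x [Ex dx]|i].
  by exists (f (connected_component E x)).
apply: diam_subsingleton => x y [Ex dx fx] [Ey dy fy].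
have : connected_component E x = connected_component E y.
  by apply: finj; rewrite ?inE; [exists x|exists y|rewrite fx fy].
by rewrite dx dy => /seteqP[/(_ x erefl)].
Qed.

(** The factor 5 in the scale comes from [diam_inflate]; the bound itself is free of it because only
    a tail of the sequence is inflated. *)
Lemma hausdorff1_delta_le_L_delta E (e : R) : locally_compact_in E ->
  countable (components E) -> (0 < e)%R ->
  hausdorff1_delta (5 * e)%:E E <= L_delta e%:E E.
Proof.
move=> lcE ctE e0.
have [->|Lfin] := eqVneq (L_delta e%:E E) +oo; first exact: leey.
have [C [cC CE Ce Cmax]] := greedy_sequence E e (ltW e0).
pose U n := \big[setU/set0]_(i < n) C i.
have CU i n : (i < n)%N -> C i `<=` U n.
  move=> ilt; rewrite /U (bigD1 (Ordinal ilt))//=; exact: subsetUl.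
have UC n x : U n x -> exists2 i, (i < n)%N & C i x.
  by rewrite /U -bigcup_mkord => -[i /= ilt Cx]; exists i.
have clU n : closed (U n).
  apply: compact_closed; first exact: metric_hausdorff.
  by apply: bigsetU_compact => i _; case: (cC i).
have sumCL n : \sum_(0 <= i < n) diam (C i) <= L_delta e%:E E.
  apply: ereal_sup_ubound; exists n, (fun i : 'I_n => C i).
  have lt_disj (i j : nat) x : (i < j)%N -> C i x -> ~ C j x.
    by move=> ij Cix /CE[_]; apply; exact: CU Cix.
  split=> //; last by rewrite big_mkord.
    by move=> i x /CE[].
  move=> i j _ _ [x [Cix Cjx]]; apply: val_inj => /=.
  have [ij|ji|//] := ltngtP i j; exfalso.
    exact: lt_disj ij Cix Cjx.
  exact: lt_disj ji Cjx Cix.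
have cvC : cvgn (fun n => \sum_(0 <= i < n) diam (C i)).
  by apply: is_cvg_nneseries => i _ _; exact: diam_ge0.
have tail0 : \sum_(N <= k <oo) diam (C k) @[N --> \oo] --> 0.
  apply: nneseries_tail_cvg => [|k _]; last exact: diam_ge0.
  apply: (@le_lt_trans _ _ (L_delta e%:E E)); last by rewrite ltey.
  by apply: lime_le => //; exact: nearW.
have small_tail (r : R) : (0 < r)%R ->
    exists N, \sum_(N <= k <oo) diam (C k) < r%:E.
  move=> r0; have /tail0[N _ NP] := @nbhs_open_ereal_lt _ 0%R (fun=> r) r0.
  by exists N; apply: NP => /=.
have coverE N x : E x -> ~ degenerate E x -> ~ U N x ->
    exists2 n, (N <= n)%N & inflate (C n) x.
  move=> Ex ndx nUx.
  have [D [Dx DEU cD De [y Dy yx]]] :=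
    nondegenerate_subcontinuum E (U N) x e lcE (clU N) nUx Ex ndx e0.
  have {}De : diam D <= e%:E.
    apply: diam_le => [|z t Dz Dt]; rewrite lee_fin; [exact: ltW|exact: De].
  have D0 : (0 < mdist x y)%R by rewrite mdist_gt0; apply/eqP => /esym.
  have xyD := mdist_le_diam _ _ _ Dx Dy.
  (* Otherwise [D] would be available at every stage, so [diam D] would be at most twice every
     [diam (C n)]; these tend to 0, while [diam D] is at least [mdist x y]. *)
  have DmeetU : exists n, `[< D `&` U n !=set0 >].
    apply: contrapT => /forallNP noD.
    have [|n nlt] := small_tail (mdist x y / 2)%R; first by rewrite divr_gt0.
    have : diam D <= 2%:E * diam (C n).
      apply: Cmax => // z Dz; split; first by case: (DEU _ Dz).
      by move=> Uz; apply: (noD n); apply/asboolP; exists z.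
    have : diam (C n) < (mdist x y / 2)%:E.
      apply: le_lt_trans nlt.
      rewrite (@nneseries_split _ _ n 1) => [|k _]; last exact: diam_ge0.
      rewrite addn1 big_nat1 leeDl// nneseries_ge0// => k _ _; exact: diam_ge0.
    move=> Cn DC; move: (le_trans xyD DC).
    have Cfin : diam (C n) \is a fin_num.
      by rewrite ge0_fin_numE ?diam_ge0// (le_lt_trans (Ce n)) ?ltry.
    by move: Cn; rewrite -(fineK Cfin) -EFinM lee_fin lte_fin; lra.
  (* Take the first [U n.+1] that meets [D]: then [D] meets [C n] and was still available when [C n]
     was chosen, and [N <= n] because [D] misses [U N]. *)
  case: (ex_minnP DmeetU) => [[|n]] /asboolP[z [Dz Uz]] nmin.
    by move: Uz; rewrite /U big_ord0.
  have Dn : D `<=` E `\` U n.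
    move=> t Dt; split; first by case: (DEU _ Dt).
    move=> Ut; suff : (n < n)%N by rewrite ltnn.
    by apply: nmin; apply/asboolP; exists t.
  have Cz : C n z.
    move: Uz; rewrite /U big_ord_recr /= => -[Unz|//].
    by case: (Dn _ Dz).
  exists n.
    rewrite leqNgt; apply/negP => nN; have [_] := DEU _ Dz; apply.
    exact: CU nN _ Cz.
  exists z => //; apply: (le_trans (mdist_le_diam _ _ _ Dx Dz)).
  exact: Cmax.
have [B [EB B0]] := degenerate_null_cover E ctE.
apply/lee_addgt0Pr => r r0.
(* Inflating multiplies the tail by at most 5, so a tail below [r / 5] adds at most [r]. *)
have [|N Nr] := small_tail (r / 5)%R; first by rewrite divr_gt0.
pose A n := if (n < N)%N then C n else inflate (C n).
apply: (@le_trans _ _ (\sum_(0 <= i <oo) diam (A i))).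
  apply: (hausdorff1_deltaU_null _ _ A B) => // [|x Ex|i].
  - by rewrite lee_fin mulr_ge0// ltW.
  - have [dx|ndx] := pselect (degenerate E x); first by right; exact: EB.
    left; have [/UC[i iN Cx]|nUx] := pselect (U N x).
      by exists i => //; rewrite /A iN.
    have [n Nn nx] := coverE N x Ex ndx nUx.
    by exists n => //; rewrite /A ltnNge Nn.
  - rewrite /A; case: ifP => _.
      by apply: (le_trans (Ce i)); rewrite lee_fin; lra.
    apply: (le_trans (diam_inflate _)); rewrite EFinM.
    by rewrite lee_pmul2l ?lte_fin.
rewrite (@nneseries_split _ _ 0 N) => [|k _]; last exact: diam_ge0.
rewrite add0n; apply: leeD.
  rewrite (eq_big_nat _ _ (F2 := fun i => diam (C i))) => [|i /andP[_ iN]].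
    exact: sumCL.
  by rewrite /A iN.
apply: (@le_trans _ _ (\sum_(N <= i <oo) (5%:E * diam (C i)))).
  apply: lee_nneseries => [i _ _|i _]; first exact: diam_ge0.
  rewrite /A; case: ifP => _; last exact: diam_inflate.
  rewrite (le_trans _ (diam_inflate _))//.
  by apply: le_diam; exact: inflate_sub.
rewrite nneseriesZl => [|i _]; last exact: diam_ge0.
have -> : r = (5 * (r / 5))%R by rewrite mulrC divfK.
by rewrite EFinM lee_pmul2l ?lte_fin// ltW.
Qed.

End greedy_sequence.

Theorem theorem2p5 (R : realType) (X : metricType R) (E : set X)
    (lcE : locally_compact_in E) (ctE : countable (components E))
    (delta : \bar R) (delta_gt0 : 0 < delta) :
  hausdorff1 E = L_delta delta E.
Proof.
apply/eqP; rewrite eq_le L_delta_le_hausdorff1 andbT.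
apply: ge_ereal_sup => _ [d /= d0 <-].
(* [hausdorff1_delta] decreases and [L_delta] increases with the scale, so one [e] at most [d / 5]
   and [delta] suffices; if both are infinite, [e = 1] serves. *)
have [e [e0 ed edelta]] : exists e : R,
    [/\ (0 < e)%R, (5 * e)%:E <= d & e%:E <= delta].
  have : 0 < mine d delta by rewrite lt_min d0.
  move m : (mine d delta) => [t| |]//.
  - rewrite lte_fin => t0; exists (t / 5)%R; split; first by rewrite divr_gt0.
    + by rewrite mulrC divfK// -m ge_min lexx.
    + apply: (@le_trans _ _ t%:E); first by rewrite lee_fin; lra.
      by rewrite -m ge_min lexx orbT.
  - move=> _; exists 1%R.
    have : +oo <= mine d delta by rewrite m.
    rewrite le_min !leye_eq => /andP[/eqP -> /eqP ->].
    by split; rewrite ?leey.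
apply: (le_trans (hausdorff1_delta_le _ _ E ed)).
apply: (le_trans (hausdorff1_delta_le_L_delta E e lcE ctE e0)).
exact: L_delta_le.
Qed.
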